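(* Let $\mathcal N$ be the largest part of the square-cutting partition $\mathcal P$ and $F(u)=\Pr(\mathcal N\le u)$. Then $F(u)=\Pi(1/u)$ for all $u>0$, where $\Pi:(0,\infty)\to[0,1]$ is the function with $\Pi(u)=1$ for $u\in(0,1]$ and $$\Pi(u)=\frac1u(\Pi*\rho)(u)=\frac1u\int_0^u\Pi(t)\rho(u-t)\,dt\qquad(u>1),$$ with $\rho$ the Dickman function.
   Context: Square-cutting partition: with $\{U_{i,j}\}_{i,j\ge1}$ iid uniform on $[0,1]$, $\mathcal P$ is the random partition of unity (multiset of nonnegative numbers summing to 1) whose parts are, for $i\ge1$, $j\ge2$, $\big(\prod_{r=1}^{i-1}(1-U_{r,1})\big)U_{i,1}\big(\prod_{s=2}^{j-1}(1-U_{i,s})\big)U_{i,j}$. The Dickman function $\rho$ is the unique continuous function on $[0,\infty)$ with $\rho(u)=1$ on $[0,1]$ and $u\rho'(u)+\rho(u-1)=0$ for $u>1$; in the convolution above $\Pi$ is extended by $\Pi(0)=1$. *)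

(* Defs.v *)
From HB Require Import structures.
From mathcomp Require Import all_boot all_order all_algebra.
From mathcomp Require Import all_classical all_reals all_analysis.
From mathcomp Require Import uniform_distribution.
Set Implicit Arguments. Unset Strict Implicit. Unset Printing Implicit Defensive.
Import Order.TTheory GRing.Theory Num.Theory.
Import numFieldNormedType.Exports.
Local Open Scope classical_set_scope.
Local Open Scope ring_scope.

Definition mutually_independent d (T : measurableType d) (R : realType)
    (P : probability T R) (I : eqType) (X : I -> T -> R) : Prop :=
  forall (J : seq I) (B : I -> set R), uniq J ->
    (forall i, i \in J -> measurable (B i)) ->
    P (\bigcap_(i in [set i | i \in J]) (X i @^-1` B i)) =
    \big[*%E/1%E]_(i <- J) P (X i @^-1` B i).

Definition iid_uniform01 d (T : measurableType d) (R : realType)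
    (P : probability T R) (U : nat -> nat -> {RV P >-> R}) : Prop :=
  (forall i j (A : set R), measurable A ->
     distribution P (U i j) A = uniform_prob (@ltr01 R) A) /\
  mutually_independent P (fun ij : nat * nat => (U ij.1 ij.2 : T -> R)).

(** Part of the square-cutting partition. With the 0-based shift
    U i j := U_{i+1,j+1}, the part indexed (i+1, j+1) with j >= 1 is
    (prod_{r<i} (1 - U r 0)) * U i 0 * (prod_{1<=s<j} (1 - U i s)) * U i j. *)
Definition sc_part d (T : measurableType d) (R : realType)
    (P : probability T R) (U : nat -> nat -> {RV P >-> R})
    (i j : nat) (w : T) : R :=
  (\prod_(r < i) (1 - U r 0%N w)) * U i 0%N w *
  (\prod_(1 <= s < j) (1 - U i s w)) * U i j w.

Definition sc_largest d (T : measurableType d) (R : realType)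
    (P : probability T R) (U : nat -> nat -> {RV P >-> R}) (w : T) : R :=
  sup [set x | exists i j : nat, (0 < j)%N /\ x = sc_part U i j w].

Definition is_dickman (R : realType) (rho : R -> R) : Prop :=
  {within [set x | 0 <= x], continuous rho} /\
  (forall u, 0 <= u <= 1 -> rho u = 1) /\
  (forall u, 1 < u -> derivable rho u 1 /\ u * derive1 rho u + rho (u - 1) = 0).

Definition is_Pi (R : realType) (rho : R -> R) (Pi : R -> R) : Prop :=
  measurable_fun [set x : R | 0 <= x] Pi /\
  Pi 0 = 1 /\
  (forall u, 0 < u -> 0 <= Pi u <= 1) /\
  (forall u, 0 < u <= 1 -> Pi u = 1) /\
  (forall u, 1 < u ->
     ((Pi u)%:E = (u^-1)%:E *
        \int[lebesgue_measure]_(t in `[0%R, u]) (Pi t * rho (u - t))%:E)%E).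

(* Main.v *)
(** Let N be the largest part and G v := P (N <= 1/v). Splitting off the first
    row gives N = max (x M, (1 - x) N') with x uniform, M the largest part of a
    one-dimensional stick breaking and N' a copy of N, all independent; since
    P (M <= 1/v) = rho v, this reads G v = \int_0^1 rho (v x) G (v (1 - x)) dx,
    which is the convolution equation.

    To avoid independence of infinite families, only the parts (i, j) with
    i + j <= n are kept: these are produced by a chain that consumes one uniform
    variable at a time, and its law is an iterated integral. In the limit the
    truncated recursions give the equation for G, by dominated convergence.

    Both rho v = lim P (M_n <= 1/v) and the uniqueness of Pi come from one
    contraction: if h_n vanishes on [0, 1] and v h_(n+1) v <= \int_0^v h_n, then
    on [0, V] the sup of h_n decays like ((V - 1) / V)^n. *)
Require Import Defs.
From HB Require Import structures.
From mathcomp Require Import all_boot all_order all_algebra.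
From mathcomp Require Import all_classical all_reals all_analysis.
From mathcomp Require Import measurable_realfun uniform_distribution ring lra zify.
Set Implicit Arguments. Unset Strict Implicit. Unset Printing Implicit Defensive.
Import Order.TTheory GRing.Theory Num.Theory.
Import numFieldNormedType.Exports.
Local Open Scope classical_set_scope.
Local Open Scope ring_scope.

(** * Chains driven by independent uniform variables *)

Section chain.
Local Open Scope ereal_scope.
Context d (T : measurableType d) (R : realType) (P : probability T R).
Context dS (S : measurableType dS) (I : eqType) (X : I -> {RV P >-> R}).
(* R itself has the same measurable sets as measurableTypeR R, on which
   uniform_prob lives, but the two are not convertible as measurableType's. *)
Let Rm := measurableTypeR R.
Let unif : probability Rm R := uniform_prob (@ltr01 R).
Hypothesis lawX : forall i (A : set R), measurable A ->
  distribution P (X i) A = unif A.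
Variable step : I -> S -> R -> S.
Hypothesis mstep : forall i, measurable_fun setT (fun p : S * Rm => step i p.1 p.2).

Definition independent_of_rest (Y : T -> S) (l : seq I) :=
  forall (B : set S) (C : I -> set R), measurable B ->
    (forall i, measurable (C i)) ->
    P (Y @^-1` B `&` \bigcap_(i in [set i | i \in l]) (X i @^-1` C i)) =
    P (Y @^-1` B) * \big[*%E/1]_(i <- l) P (X i @^-1` C i).

Lemma bigcap_cons (F : I -> set T) i l :
  \bigcap_(j in [set j | j \in i :: l]) F j =
  F i `&` \bigcap_(j in [set j | j \in l]) F j.
Proof.
rewrite (_ : [set j | j \in i :: l] = i |` [set j | j \in l]).
  by rewrite bigcap_setU bigcap_set1.
apply/seteqP; split => j /=; rewrite in_cons.
  by move=> /orP[/eqP ->|]; [left|right].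
by move=> [->|->]; rewrite ?eqxx ?orbT.
Qed.

Lemma measurable_bigcap_seq (F : I -> set T) (l : seq I) :
  (forall i, measurable (F i)) ->
  measurable (\bigcap_(j in [set j | j \in l]) F j).
Proof.
move=> mF; elim: l => [|i l ih]; last by rewrite bigcap_cons; exact: measurableI.
rewrite (_ : [set j | j \in [::]] = set0) ?bigcap_set0//.
by apply/seteqP; split.
Qed.

Section one_step.
Variables (Y : {RV P >-> S}) (i : I) (l : seq I).
Hypotheses (il : i \notin l) (indY : independent_of_rest Y (i :: l)).

Let joint (w : T) : S * Rm := (Y w, X i w).
Let mjoint : measurable_fun setT joint.
Proof.
apply: (@measurable_fun_pair _ _ _ T S Rm); first exact: measurable_funP.
exact: (measurable_funP (X i)).
Qed.
HB.instance Definition _ := isMeasurableFun.Build _ _ _ _ joint mjoint.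

Let preX (j : I) (A : set R) : measurable A -> measurable (X j @^-1` A).
Proof. by move=> mA; rewrite -[X in measurable X]setTI; exact: measurable_funP. Qed.

Let PXT j : P (X j @^-1` setT) = 1.
Proof. by rewrite preimage_setT probability_setT. Qed.

(** The condition [B] on [X i] is absorbed into the family by redefining [C] at [i]; as [i] is not
    in [l], the other factors stay the same. *)
Lemma joint_law_rect_restr (A : set S) (B : set Rm) (C : I -> set R) :
  measurable A -> measurable B -> (forall j, measurable (C j)) ->
  P (joint @^-1` (A `*` B) `&` \bigcap_(j in [set j | j \in l]) (X j @^-1` C j))
  = P (Y @^-1` A) * unif B * \big[*%E/1]_(j <- l) P (X j @^-1` C j).
Proof.
move=> mA mB mC; pose C2 j := if j == i then B else C j.
have mC2 j : measurable (C2 j).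
  rewrite /C2; case: ifP => _; [exact: mB|exact: mC].
have eqC2 j : j \in l -> C2 j = C j.
  by rewrite /C2; case: eqVneq => // ->; rewrite (negbTE il).
have := indY mA mC2; rewrite bigcap_cons big_cons {1 3}/C2 eqxx.
rewrite (eq_bigcapr (fun j jl => congr1 (preimage (X j)) (eqC2 j jl))).
have -> : \big[*%E/1]_(j <- l) P (X j @^-1` C2 j) =
          \big[*%E/1]_(j <- l) P (X j @^-1` C j).
  by apply: eq_big_seq => j jl; rewrite eqC2.
by rewrite setIA muleA -(lawX i)// => <-.
Qed.

Lemma joint_law_rect (A : set S) (B : set Rm) : measurable A -> measurable B ->
  P (joint @^-1` (A `*` B)) = P (Y @^-1` A) * unif B.
Proof.
move=> mA mB.
have := joint_law_rect_restr mA mB (fun _ => measurableT).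
rewrite big1 ?mule1; last by move=> j _; exact: PXT.
by rewrite (_ : \bigcap_(j in _) _ = setT) ?setIT//; apply/seteqP; split.
Qed.

(** Rectangles determine the measure: the law of [joint] restricted to the event on [l], and the law
    of [joint] scaled by [p], agree on them with one product measure. *)
Lemma joint_law_restr (C : I -> set R) (E : set (S * Rm)) :
  (forall j, measurable (C j)) -> measurable E ->
  P (joint @^-1` E `&` \bigcap_(j in [set j | j \in l]) (X j @^-1` C j)) =
  P (joint @^-1` E) * \big[*%E/1]_(j <- l) P (X j @^-1` C j).
Proof.
move=> mC mE.
set D := \bigcap_(j in _) _.
have mD : measurable D by apply: measurable_bigcap_seq => j; exact: preX.
set p := \big[*%E/1]_(j <- l) _.
(* Scaling a measure takes a nonnegative real factor, so [p] must be shown finite. *)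
have p0 : 0 <= p by apply: prode_ge0 => j _; exact: measure_ge0.
have pfin : p \is a fin_num.
  apply: (big_ind (fun x => x \is a fin_num)) => // [x y ? ?|j _].
    by rewrite fin_numM.
  by rewrite fin_num_measure//; exact: preX.
pose r : {nonneg R} := NngNum (fine_ge0 p0).
pose m1 := mscale r (distribution P Y).
pose mu1 := pushforward (mrestr P mD) joint.
pose mu2 := mscale r (distribution P joint).
have rE : r%:num%:E = p by rewrite fineK.
have e1 : (m1 \x unif) E = mu1 E.
  apply: product_measure_unique => // A B mA mB.
  transitivity (P (joint @^-1` (A `*` B) `&` D)) => //.
  transitivity (p * P (Y @^-1` A) * unif B); last by rewrite -rE.
  by rewrite joint_law_rect_restr// -/p [LHS]muleC muleA.
have e2 : (m1 \x unif) E = mu2 E.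
  apply: product_measure_unique => // A B mA mB.
  transitivity (p * P (joint @^-1` (A `*` B))); first by rewrite -rE.
  transitivity (p * P (Y @^-1` A) * unif B); last by rewrite -rE.
  by rewrite joint_law_rect// muleA.
transitivity (mu1 E) => //; rewrite -e1 e2.
by rewrite muleC -rE.
Qed.

Lemma independent_of_rest_step :
  independent_of_rest (fun w => step i (Y w) (X i w)) l.
Proof.
move=> B C mB mC.
pose E := (fun p : S * Rm => step i p.1 p.2) @^-1` B.
apply: (@joint_law_restr C E) => //.
by rewrite -[E]setTI; exact: (@mstep i).
Qed.

(** The joint law is a product measure, since it is one on rectangles; Tonelli then applies. *)
Lemma integral_step (h : S -> \bar R) : measurable_fun [set: S] h ->
  (forall s, 0 <= h s) ->
  \int[P]_w h (step i (Y w) (X i w)) =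
  \int[P]_w \int[unif]_x h (step i (Y w) x).
Proof.
move=> mh h0.
pose f (p : S * Rm) := h (step i p.1 p.2).
have mf : measurable_fun setT f by exact: measurableT_comp.
transitivity (\int[distribution P joint]_p f p).
  by rewrite ge0_integral_distribution// => p; exact: h0.
transitivity (\int[distribution P Y \x unif]_p f p).
  apply: eq_measure_integral => E mE _; apply/esym/product_measure_unique => //.
  by move=> A B mA mB; exact: joint_law_rect.
rewrite fubini_tonelli1//; last by move=> p; exact: h0.
rewrite ge0_integral_distribution//.
- by apply: measurable_fun_fubini_tonelli_F => // p; exact: h0.
- by move=> y; apply: integral_ge0 => x _; exact: h0.
Qed.

End one_step.

(* Value function of the chain: backward phi l s is the expectation of phi at the
   end of a run from s that consumes the variables indexed by l. *)
Definition backward (phi : S -> \bar R) (l : seq I) : S -> \bar R :=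
  foldr (fun i h s => \int[unif]_x h (step i s x)) phi l.

Lemma backward_ge0 phi l : (forall s, 0 <= phi s) ->
  forall s, 0 <= backward phi l s.
Proof.
by move=> phi0; elim: l => //= i l ih s; apply: integral_ge0 => x _; exact: ih.
Qed.

Lemma measurable_backward phi l : measurable_fun setT phi ->
  (forall s, 0 <= phi s) -> measurable_fun setT (backward phi l).
Proof.
move=> mphi phi0; elim: l => //= i l ih.
apply: (measurable_fun_fubini_tonelli_F
  (fun p : S * Rm => backward phi l (step i p.1 p.2))).
  exact: measurableT_comp.
by move=> p; exact: backward_ge0.
Qed.

(** Induction on [l] for all [Y]: a step consumes the head, and the new state is again independent
    of the tail. *)
Lemma integral_chain (phi : S -> \bar R) (l : seq I) (Y : {RV P >-> S}) :
  uniq l -> independent_of_rest Y l -> measurable_fun setT phi ->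
  (forall s, 0 <= phi s) ->
  \int[P]_w phi (foldl (fun s i => step i s (X i w)) (Y w) l) =
  \int[P]_w backward phi l (Y w).
Proof.
move=> + + mphi phi0; elim: l Y => //= i l ih Y /andP[il ul] indY.
have mY' : measurable_fun setT (fun w => step i (Y w) (X i w)).
  have mj : measurable_fun setT (fun w => (Y w, X i w) : S * Rm).
    apply: (@measurable_fun_pair _ _ _ T S Rm); first exact: measurable_funP.
    exact: (measurable_funP (X i)).
  exact: (measurableT_comp (mstep i) mj).
pose Y' : {RV P >-> S} := mfun_Sub (mem_set mY').
have -> := ih Y' ul (independent_of_rest_step il indY).
apply: (@integral_step Y i l il indY (backward phi l)).
  exact: measurable_backward.
exact: backward_ge0.
Qed.

End chain.

(** * Changes of variables and contraction *)

Section rescaling.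
Local Open Scope ereal_scope.
Context (R : realType).
Local Notation mu := (@lebesgue_measure R).
Let Rm := measurableTypeR R.

(** Substitution t = v (1 - x) for a merely measurable [f]: [v] times the image of Lebesgue measure
    under this map is Lebesgue measure, by comparison on half-open intervals. *)
Lemma ge0_integral_rescale (v : R) (f : R -> \bar R) : (0 < v)%R ->
  measurable_fun setT f -> (forall x, 0 <= f x) ->
  \int[mu]_(t in `[0%R, v]) f t =
  v%:E * \int[mu]_(x in `[0%R, 1%R]) f (v * (1 - x))%R.
Proof.
move=> v0 mf f0.
pose phi (x : Rm) : Rm := (v * (1 - x))%R.
have mphi : measurable_fun setT phi.
  apply: (@measurable_funM _ _ _ _ (cst v) (fun x : Rm => 1 - x)%R) => //.
  exact: measurable_funB.
have phiE c x : (1 - c / v <= x)%R = (phi x <= c)%R.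
  by rewrite /phi lerBlDr -lerBlDl ler_pdivlMr// mulrC.
pose k : {nonneg R} := NngNum (ltW v0).
pose nu0 := mscale k (pushforward mu phi).
pose nu := nu0 mphi.
have nuE (A : set Rm) : measurable A -> mu A = nu A.
  apply: lebesgue_measure_unique => _ [[a b] _ <-] /=.
  rewrite /nu /nu0 /mscale/= /pushforward.
  have -> : phi @^-1` `]a%R, b%R]%classic = `[(1 - b / v)%R, (1 - a / v)%R[%classic.
    have e x : (1 - b / v <= x < 1 - a / v)%R = (a < phi x <= b)%R.
      by rewrite phiE [(x < _)%R]ltNge phiE -ltNge andbC.
    by apply/seteqP; split => x /=; rewrite !in_itv /= e.
  rewrite !lebesgue_measure_itv/= !lte_fin.
  rewrite ltrD2l ltrN2 ltr_pM2r ?invr_gt0//.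
  case: ifPn => _; last by rewrite mule0.
  rewrite -!EFinD -EFinM; congr EFin; field.
  exact: lt0r_neq0.
rewrite (@eq_measure_integral _ _ _ _ nu); last by move=> A mA _; exact: nuE.
have mfD (D : set Rm) : measurable_fun D f by exact: measurable_funTS.
rewrite (@ge0_integral_mscale _ _ _ (pushforward mu phi))//.
rewrite (@ge0_integral_pushforward _ _ _ _ _ phi)//=.
congr (_ * integral _ _ _).
have e x : (0 <= phi x <= v)%R = (0 <= x <= 1)%R.
  by rewrite -phiE divff ?lt0r_neq0// subrr andbC /phi pmulr_rge0// subr_ge0 andbC.
by apply/seteqP; split => x /=; rewrite !in_itv /= e.
Qed.
End rescaling.

Lemma integrable_bounded d (T : measurableType d) (R : realType)
    (m : {measure set T -> \bar R}) (D : set T) (f : T -> R) (M : R) :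
  measurable D -> (m D < +oo)%E -> measurable_fun D f ->
  (forall x, D x -> `|f x| <= M) -> m.-integrable D (EFin \o f).
Proof.
move=> mD mDoo mf fM; apply: measurable_bounded_integrable => //.
exists M; split; first exact: num_real.
by move=> N MN x /= Dx; apply: le_trans (fM _ Dx) (ltW MN).
Qed.

Lemma lebesgue_itv0_lty (R : realType) (v : R) :
  (@lebesgue_measure R `[0%R, v] < +oo)%E.
Proof. by rewrite lebesgue_measure_itv/=; case: ifP => _; rewrite ltry. Qed.

Section contraction.
Context (R : realType).
Local Notation mu := (@lebesgue_measure R).

Lemma iterated_average_decay (h : nat -> R -> R) (V C : R) :
  1 <= V -> (forall n x, 0 <= x <= 1 -> h n x = 0) ->
  (forall n x, 0 <= x <= V -> 0 <= h n x) ->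
  (forall n v, 0 <= v <= V -> mu.-integrable `[0, v] (EFin \o h n)) ->
  (forall x, 0 <= x <= V -> h 0 x <= C) ->
  (forall n v, 1 < v <= V -> v * h n.+1 v <= \int[mu]_(t in `[0, v]) h n t) ->
  forall n v, 0 <= v <= V -> h n v <= C * ((V - 1) / V) ^+ n.
Proof.
move=> V1 h01 h_ge0 hint h0C hS.
elim=> [|n ih] v vV; first by rewrite expr0 mulr1; exact: h0C.
set q := (V - 1) / V.
have V0 : 0 < V by exact: lt_le_trans V1.
have q0 : 0 <= q by rewrite divr_ge0 ?subr_ge0// ltW.
have C0 : 0 <= C.
  by apply: le_trans (h0C 0 _); rewrite ?h_ge0 ?lexx//= ltW.
have [v1|v1] := leP v 1.
  by rewrite h01 ?mulr_ge0 ?exprn_ge0//; move/andP: vV => [-> _].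
have v0 : 0 < v by exact: lt_trans v1.
have /andP[_ vV'] := vV.
(* As h n vanishes on [0, 1], the integral sees only a length v - 1, and
   (v - 1) / v <= q. *)
pose K := C * q ^+ n.
have bound : \int[mu]_(t in `[0, v]) h n t <= K * (v - 1).
  pose g t := K * \1_(`]1, v]) t.
  have mg : measurable_fun setT g.
    by apply: measurable_funM => //; exact: measurable_indic.
  have -> : K * (v - 1) = \int[mu]_(t in `[0, v]) g t.
    rewrite RintegralZl//; last first.
      apply: (@integrable_bounded _ _ _ _ _ _ 1) => //.
      - exact: lebesgue_itv0_lty.
      - by move=> x _; rewrite indicE; case: (_ \in _); rewrite ?normr1 ?normr0.
    rewrite /Rintegral integral_indic// setIidl; last first.
      by move=> x /=; rewrite !in_itv /= => /andP[x1 ->]; rewrite (le_trans _ (ltW x1)).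
    by have := lebesgue_measure_itv `]1, v] => /=; rewrite lte_fin v1 => ->.
  apply: le_Rintegral => //; first by apply: hint; rewrite ltW.
    apply: (@integrable_bounded _ _ _ _ _ _ K) => //.
    - exact: lebesgue_itv0_lty.
    - exact: measurable_funTS.
    - move=> x _; rewrite /g indicE; case: (_ \in _); rewrite ?mulr1 ?mulr0 ?normr0 ?ger0_norm//;
      by rewrite mulr_ge0// exprn_ge0.
  move=> t /=; rewrite in_itv /= => /andP[t0 tv].
  rewrite /g indicE; have [t1|t1] := leP t 1.
    by rewrite h01 ?t0// mulr_ge0// mulr_ge0// exprn_ge0.
  rewrite mem_set ?mulr1; last by rewrite /= in_itv/= t1.
  by apply: ih; rewrite t0 (le_trans tv).
have := hS n v; rewrite v1 vV' => /(_ isT) /le_trans /(_ bound).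
rewrite mulrC -ler_pdivlMr// => /le_trans; apply.
rewrite exprSr mulrA -/K -mulrA; apply: ler_wpM2l.
  by rewrite mulr_ge0// exprn_ge0.
rewrite /q ler_pdivrMr// mulrAC ler_pdivlMr//; nra.
Qed.

End contraction.

(** * Convolution along a uniformly broken stick *)

Section stick_convolution.
Context (R : realType).
Local Notation mu := (@lebesgue_measure R).
Let Rm := measurableTypeR R.
Let unif : probability Rm R := uniform_prob (@ltr01 R).

Definition unit_valued (f : R -> R) :=
  measurable_fun setT f /\ forall x, 0 <= f x <= 1.

(* If X and Y are independent with P (X <= 1/v) = r v and P (Y <= 1/v) = g v, and
   x is an independent uniform variable, then
   P (max (x X, (1 - x) Y) <= 1/v) = stick_conv r g v. *)
Definition stick_conv (r g : R -> R) (v : R) : R :=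
  \int[unif]_x (r (v * x) * g (v * (1 - x))).

Lemma integral_unif01 (f : R -> \bar R) : measurable_fun setT f ->
  (forall x, 0 <= f x)%E ->
  (\int[unif]_x f x = \int[mu]_(x in `[0%R, 1%R]) f x)%E.
Proof.
by move=> mf f0; rewrite (integral_uniform (ltr01 : 0 < 1 :> R) mf f0) subr0 invr1 mul1e.
Qed.

Section unit_valued.
Variables (r g : R -> R).
Hypotheses (ur : unit_valued r) (ug : unit_valued g).

Let mr : measurable_fun setT r := ur.1.
Let mg : measurable_fun setT g := ug.1.

Lemma unit_valuedM x y : 0 <= r x * g y <= 1.
Proof.
have /andP[r0 r1] := ur.2 x; have /andP[g0 g1] := ug.2 y.
by rewrite mulr_ge0//= mulr_ile1.
Qed.

Lemma measurable_stick_integrand2 :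
  measurable_fun setT (fun p : Rm * Rm => r (p.1 * p.2) * g (p.1 * (1 - p.2))).
Proof.
have m1 : measurable_fun setT (fun p : Rm * Rm => p.1 : R) by exact: measurable_fst.
have m2 : measurable_fun setT (fun p : Rm * Rm => p.2 : R) by exact: measurable_snd.
apply: measurable_funM; apply: measurableT_comp => //; apply: measurable_funM => //.
exact: measurable_funB.
Qed.

Lemma measurable_stick_integrand v :
  measurable_fun setT (fun x : Rm => r (v * x) * g (v * (1 - x))).
Proof.
apply: measurable_funM; apply: measurableT_comp => //; apply: measurable_funM => //.
exact: measurable_funB.
Qed.

Lemma EFin_stick_conv v : (stick_conv r g v)%:E =
  (\int[unif]_x (r (v * x) * g (v * (1 - x)))%:E)%E.
Proof.
rewrite /stick_conv /Rintegral fineK//; apply: integrable_fin_num => //.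
apply: (@integrable_bounded _ _ _ _ _ _ 1) => //.
- by rewrite -ge0_fin_numE// fin_num_measure.
- exact: measurable_stick_integrand.
- by move=> x _; have /andP[h0 h1] := unit_valuedM (v * x) (v * (1 - x)); rewrite ger0_norm.
Qed.

(** Measurability in [v] is that of a partial integral of the two-variable integrand; the bounds
    hold because [unif] has mass 1. *)
Lemma unit_valued_stick_conv : unit_valued (stick_conv r g).
Proof.
split.
  apply: (measurableT_comp (@fine_measurable R setT measurableT)).
  apply: (measurable_fun_fubini_tonelli_F (m2 := unif)
    (fun p : Rm * Rm => (r (p.1 * p.2) * g (p.1 * (1 - p.2)))%:E)).
    by apply/measurable_EFinP; exact: measurable_stick_integrand2.
  by move=> p; rewrite lee_fin; case/andP: (unit_valuedM (p.1 * p.2) (p.1 * (1 - p.2))).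
move=> v; rewrite -!lee_fin EFin_stick_conv; apply/andP; split.
  apply: integral_ge0 => x _; rewrite lee_fin.
  by case/andP: (unit_valuedM (v * x) (v * (1 - x))).
have -> : 1%:E = (\int[unif]_x (cst 1%:E x))%E.
  rewrite integral_cst// [X in (_ * X)%E](_ : _ = 1%E) ?mule1//.
  exact: (@probability_setT _ _ _ unif).
apply: ge0_le_integral => //.
- by move=> x _; rewrite lee_fin; case/andP: (unit_valuedM (v * x) (v * (1 - x))).
- by apply/measurable_EFinP; exact: measurable_stick_integrand.
- by move=> x _; rewrite lee_fin; case/andP: (unit_valuedM (v * x) (v * (1 - x))).
Qed.

Lemma stick_conv_eq1 : (forall x, 0 <= x <= 1 -> r x = 1) ->
  (forall x, 0 <= x <= 1 -> g x = 1) ->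
  forall v, 0 <= v <= 1 -> stick_conv r g v = 1.
Proof.
move=> r1 g1 v /andP[v0 v1]; apply: EFin_inj; rewrite EFin_stick_conv.
rewrite integral_unif01; last 2 first.
- by apply/measurable_EFinP; exact: measurable_stick_integrand.
- by move=> x; rewrite lee_fin; case/andP: (unit_valuedM (v * x) (v * (1 - x))).
transitivity (\int[mu]_(x in `[0%R, 1%R]) cst 1%:E x)%E.
  apply: eq_integral => x; rewrite inE/= in_itv/= => /andP[x0 x1].
  by rewrite r1 ?g1 ?mulr1//; apply/andP; split; nra.
rewrite integral_cst//; have := lebesgue_measure_itv `[0 : R, 1 : R] => /=.
by rewrite lte_fin ltr01 oppr0 adde0 => ->; rewrite mul1e.
Qed.

(** Substituting t = v (1 - x) turns the average over the break point into a convolution, as v x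
    becomes v - t. *)
Lemma stick_convE v : 0 < v -> (v * stick_conv r g v)%:E =
  (\int[mu]_(t in `[0%R, v]) (g t * r (v - t))%:E)%E.
Proof.
move=> v0; rewrite EFinM EFin_stick_conv integral_unif01; last 2 first.
- by apply/measurable_EFinP; exact: measurable_stick_integrand.
- by move=> x; rewrite lee_fin; case/andP: (unit_valuedM (v * x) (v * (1 - x))).
rewrite (ge0_integral_rescale v0); last 2 first.
- apply/measurable_EFinP/measurable_funM => //; apply: measurableT_comp => //.
  exact: measurable_funB.
- by move=> t; rewrite lee_fin mulrC; case/andP: (unit_valuedM (v - t) t).
congr (_ * _)%E; apply: eq_integral => x _.
by rewrite mulrC; congr ((_ * r _)%:E); ring.
Qed.

End unit_valued.
End stick_convolution.

(** * The averaging form of the Dickman equation *)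

Section dickman_extension.
Context (R : realType).
Local Notation mu := (@lebesgue_measure R).
Variable rho : R -> R.
Hypothesis rhoD : is_dickman rho.

(* Extending by 1 to the negative reals makes rho continuous on the whole line. *)
Definition extend1 (x : R) : R := if x < 0 then 1 else rho x.

Lemma extend1E x : 0 <= x -> extend1 x = rho x.
Proof. by rewrite /extend1 ltNge => ->. Qed.

Lemma extend1_eq1 x : x <= 1 -> extend1 x = 1.
Proof.
move=> x1; rewrite /extend1; case: ltP => // x0.
by rewrite rhoD.2.1// x0.
Qed.

Lemma near_extend1E (x : R) : 0 < x -> \forall y \near x, extend1 y = rho y.
Proof.
move=> x0; near=> y; apply: extend1E; apply: ltW; near: y.
exact: lt_nbhsr.
Unshelve. all: by end_near. Qed.

Lemma continuous_extend1 : continuous extend1.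
Proof.
move=> x; have [x1|x1] := ltP x 1.
  have : \forall y \near x, extend1 y = 1.
    near=> y; apply: extend1_eq1; apply: ltW; near: y.
    exact: lt_nbhsl.
  by move=> /near_cst_continuous.
have x0 : 0 < x by exact: lt_le_trans x1.
have crho : {in [set x : R | 0 < x], continuous rho}.
  rewrite -continuous_open_subspace; last exact: open_gt.
  by apply: continuous_subspaceW rhoD.1 => y /= /ltW.
rewrite /continuous_at extend1E ?ltW//.
apply: cvg_trans (crho x _); last by rewrite inE.
apply: near_eq_cvg; near=> y; apply/esym; near: y; exact: near_extend1E.
Unshelve. all: by end_near. Qed.

Lemma derive_extend1 (u : R) : 1 < u ->
  derivable extend1 u 1 /\ u * derive1 extend1 u = - extend1 (u - 1).
Proof.
move=> u1; have u0 : 0 < u by exact: lt_trans u1.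
have [drho erho] := rhoD.2.2 u u1; split.
  apply: near_eq_derivable drho.
  by near=> y; apply/esym; near: y; exact: near_extend1E.
rewrite extend1E ?subr_ge0 ?ltW//.
move/eqP: erho; rewrite addr_eq0 => /eqP <-; congr (_ * _).
rewrite !derive1E; apply: near_eq_derive.
exact: near_extend1E.
Unshelve. all: by end_near. Qed.

End dickman_extension.

Section dickman_average.
Context (R : realType).
Local Notation mu := (@lebesgue_measure R).
Variable e : R -> R.
Hypotheses (ce : continuous e) (e1 : forall x, x <= 1 -> e x = 1).
Hypothesis de : forall u, 1 < u ->
  derivable e u 1 /\ u * derive1 e u = - e (u - 1).

Let inte a b : mu.-integrable `[a, b] (EFin \o e).
Proof.
apply: continuous_compact_integrable; first exact: segment_compact.
exact: continuous_subspaceT.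
Qed.

Let csub1 : continuous (fun x : R => x - 1).
Proof. by move=> x; apply: cvgB; [exact: cvg_id|exact: cvg_cst]. Qed.

Let ces : continuous (fun x : R => e (x - 1)).
Proof. by move=> x; apply: continuous_comp; [exact: csub1|exact: ce]. Qed.

Let intes a b : mu.-integrable `[a, b] (EFin \o (fun x : R => e (x - 1))).
Proof.
apply: continuous_compact_integrable; first exact: segment_compact.
exact: continuous_subspaceT.
Qed.

Lemma Rintegral_sub1 (v : R) : 1 < v ->
  \int[mu]_(x in `[1, v]) e (x - 1) = \int[mu]_(x in `[0, v - 1]) e x.
Proof.
move=> v1; rewrite /Rintegral; congr fine.
have d1 (x : R) : is_derive x (1 : R) (fun x : R => x - 1) 1.
  by apply: is_derive_eq; rewrite subr0.
have D1 : derive1 (fun x : R => x - 1) = cst 1.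
  by apply/funext => x; rewrite derive1E derive_val.
have := @integration_by_substitution_increasing R (fun x : R => x - 1) e 1 v (ltW v1).
rewrite subrr => ->.
- apply: eq_integral => x _; congr EFin; rewrite /= D1.
  by rewrite [RHS]mulr1.
- by move=> x y _ _ xy; rewrite ltrD2r.
- by rewrite D1 => x _; exact: cvg_cst.
- by rewrite D1; exact: is_cvg_cst.
- by rewrite D1; exact: is_cvg_cst.
- split.
  + by move=> x _; apply: ex_derive.
  + by apply: cvg_at_right_filter; exact: csub1.
  + by apply: cvg_at_left_filter; exact: csub1.
- exact: continuous_subspaceT.
Qed.

(** By the delay equation, x * e x has derivative e x - e (x - 1) for x > 1, and it equals 1 at x =
    1. *)
Lemma dickman_FTC (v : R) : 1 < v ->
  \int[mu]_(x in `[1, v]) (e x - e (x - 1)) = v * e v - 1.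
Proof.
move=> v1; rewrite /Rintegral.
have dF (x : R) : 1 < x -> is_derive x (1 : R) (fun x : R => x * e x) (e x - e (x - 1)).
  move=> x1; have [dx ex] := de x1.
  have dd : is_derive x (1 : R) e (derive1 e x) by rewrite derive1E; exact: derivableP.
  have := @is_deriveM _ _ id e x 1 _ _ _ dd.
  move=> /(_ _ (is_derive_id _ _)).
  move=> h.
  suff <- : x *: derive1 e x + (e x)%:A = e x - e (x - 1) by exact: h.
  by rewrite -ex addrC /GRing.scale/= mulr1.
have cF : continuous (fun x : R => x * e x).
  by move=> x; apply: cvgM; [exact: cvg_id|exact: ce].
rewrite (@continuous_FTC2 R _ (fun x : R => x * e x) 1 v v1).
- by rewrite -EFinB/= mul1r (e1 (lexx 1)).
- by apply: continuous_subspaceT => x; apply: cvgB; [exact: ce|exact: ces].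
- split.
  + by move=> x; rewrite in_itv/= => /andP[x1 _]; have [] := dF _ x1.
  + by apply: cvg_at_right_filter; exact: cF.
  + by apply: cvg_at_left_filter; exact: cF.
- move=> x; rewrite in_itv/= => /andP[x1 _]; rewrite derive1E.
  by have [_ ->] := dF _ x1.
Qed.

(** The 1 in [dickman_FTC] is the integral of [e] over [0, 1], so v * e v is the integral of [e]
    over [v - 1, v], the range selected by the indicator. Thus [e] is fixed beyond 1 by the
    recursion that defines [dickman_approx]. *)
Lemma dickman_average (v : R) : 1 < v ->
  v * e v = \int[mu]_(t in `[0, v]) (e t * \1_`]-oo, 1] (v - t)).
Proof.
move=> v1; have v0 : 0 < v by exact: lt_trans v1.
have := dickman_FTC v1; rewrite RintegralB// Rintegral_sub1// => E.
have i01 : \int[mu]_(x in `[0, 1]) e x = 1.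
  rewrite (@eq_Rintegral _ _ _ _ _ (cst 1)); last first.
    by move=> x; rewrite inE/= in_itv/= => /andP[_ /e1].
  rewrite Rintegral_cst//; have := lebesgue_measure_itv `[0 : R, 1 : R] => /=.
  by rewrite lte_fin ltr01 oppr0 adde0 => ->; rewrite mul1r.
have itvB a b : 0 <= a -> a <= b ->
    \int[mu]_(x in `[0, b]) e x - \int[mu]_(x in `[0, a]) e x =
    \int[mu]_(x in `[a, b]) e x.
  move=> a0 ab; rewrite (@Rintegral_itvB _ _ _ _ a (inte 0 b))// ?bnd_simp//.
  rewrite Rintegral_itv_obnd_cbnd//; apply: integrableS (inte a b) => // x /=.
  by rewrite !in_itv/= => /andP[/ltW -> ->].
have s1 := itvB 1 v ler01 (ltW v1).
have s2 : \int[mu]_(x in `[0, v]) e x - \int[mu]_(x in `[0, v - 1]) e x =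
          \int[mu]_(x in `[v - 1, v]) e x.
  by apply: itvB; [rewrite subr_ge0 ltW|rewrite gerBl].
have -> : \int[mu]_(t in `[0, v]) (e t * \1_`]-oo, 1] (v - t)) =
          \int[mu]_(x in `[v - 1, v]) e x.
  rewrite (_ : `[v - 1, v]%classic = `[0, v] `&` `[v - 1, +oo[); last first.
    apply/seteqP; split => t /=; rewrite !in_itv/= andbT.
      by move=> /andP[t1 ->]; rewrite t1 andbT; split => //; rewrite (le_trans _ t1)// subr_ge0 ltW.
    by move=> [/andP[_ ->] ->].
  rewrite Rintegral_mkcondr; apply: eq_Rintegral => t _.
  rewrite patchE indicE.
  have -> : (v - t \in `]-oo, 1]%classic) = (t \in `[v - 1, +oo[%classic).
    by apply/idP/idP; rewrite !inE/= !in_itv/= ?andbT !lerBlDr addrC.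
  by case: ifP => _; rewrite ?mulr1 ?mulr0.
by rewrite -s2 -[LHS](subrK 1) -E -s1 i01; ring.
Qed.

End dickman_average.

(** * Truncated recursions and their limits *)

Section approximants.
Context (R : realType).
Local Notation mu := (@lebesgue_measure R).

Definition at_most1 : R -> R := \1_`]-oo, 1].

(* The probability that the first n pieces of a broken stick of length v are at
   most 1: a broken stick is its first piece and a shorter broken stick. *)
Definition dickman_approx (n : nat) : R -> R :=
  iter n (stick_conv at_most1) (cst 1).

(* The probability that the parts (i, j) with i + j <= n of the square-cutting
   partition, scaled by v, are at most 1: the first row contributes n pieces, and
   the remaining rows form the triangle of size n - 1. *)
Fixpoint square_cutting_approx (n : nat) : R -> R :=
  if n is m.+1 then stick_conv (dickman_approx n) (square_cutting_approx m)
  else cst 1.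

Lemma unit_valued_at_most1 : unit_valued at_most1.
Proof.
split; first exact: measurable_indic.
by move=> x; rewrite /at_most1 indicE; case: (_ \in _); rewrite lexx ler01.
Qed.

Lemma unit_valued_cst1 : unit_valued (cst 1 : R -> R).
Proof. by split => // x; rewrite /= lexx ler01. Qed.

Lemma at_most1_eq1 x : 0 <= x <= 1 -> at_most1 x = 1.
Proof. by move=> /andP[_ x1]; rewrite /at_most1 indicE mem_set//= in_itv. Qed.

Lemma unit_valued_dickman_approx n : unit_valued (dickman_approx n).
Proof.
elim: n => [|n ih]; first exact: unit_valued_cst1.
exact: unit_valued_stick_conv unit_valued_at_most1 ih.
Qed.

Lemma dickman_approx_eq1 n x : 0 <= x <= 1 -> dickman_approx n x = 1.
Proof.
elim: n x => // n ih; apply: stick_conv_eq1 => //.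
- exact: unit_valued_at_most1.
- exact: unit_valued_dickman_approx.
- exact: at_most1_eq1.
Qed.

Lemma unit_valued_square_cutting_approx n : unit_valued (square_cutting_approx n).
Proof.
elim: n => [|n ih]; first exact: unit_valued_cst1.
exact: unit_valued_stick_conv (unit_valued_dickman_approx n.+1) ih.
Qed.

Lemma square_cutting_approx_eq1 n x :
  0 <= x <= 1 -> square_cutting_approx n x = 1.
Proof.
elim: n x => // n ih; apply: stick_conv_eq1 => //.
- exact: unit_valued_dickman_approx.
- exact: unit_valued_square_cutting_approx.
- exact: dickman_approx_eq1.
Qed.

Lemma Rintegral_stick_conv (r g : R -> R) v : unit_valued r -> unit_valued g ->
  0 < v -> v * stick_conv r g v = \int[mu]_(t in `[0, v]) (g t * r (v - t)).
Proof. by move=> ur ug v0; rewrite /Rintegral -stick_convE. Qed.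

(** As [k] lies in [0, 1], averaging against it cannot enlarge distances; this supplies the
    inequality that [iterated_average_decay] asks for. *)
Lemma normr_kernel_average_sub (p q k : R -> R) (v : R) :
  mu.-integrable `[0, v] (EFin \o p) -> mu.-integrable `[0, v] (EFin \o q) ->
  unit_valued k ->
  `|\int[mu]_(t in `[0, v]) (p t * k (v - t)) -
    \int[mu]_(t in `[0, v]) (q t * k (v - t))| <=
  \int[mu]_(t in `[0, v]) `|p t - q t|.
Proof.
move=> ip iq [mk k01].
have mkv : measurable_fun setT (fun t : R => k (v - t)).
  by apply: measurableT_comp => //; exact: measurable_funB.
have kle1 t : `|k (v - t)| <= 1.
  by have /andP[k0 k1] := k01 (v - t); rewrite ger0_norm.
have mulk f : mu.-integrable `[0, v] (EFin \o f) ->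
    mu.-integrable `[0, v] (EFin \o (fun t => f t * k (v - t))).
  move=> intf; apply: (le_integrable _ _ _ intf) => //.
    apply/measurable_EFinP/measurable_funM; last exact: measurable_funTS.
    by case/integrableP : intf => /measurable_EFinP.
  by move=> t _ /=; rewrite lee_fin normrM ler_piMr.
have isub : mu.-integrable `[0, v] (EFin \o (fun t => p t - q t)).
  exact: (integrableB _ ip iq).
have ikB : mu.-integrable `[0, v] (EFin \o (fun t => p t * k (v - t) - q t * k (v - t))).
  exact: (integrableB _ (mulk _ ip) (mulk _ iq)).
rewrite -RintegralB//; try exact: mulk.
apply: (le_trans (le_normr_Rintegral _ ikB)) => //.
apply: le_Rintegral => //.
- exact: (integrable_norm ikB).
- exact: (integrable_norm isub).
- by move=> t _; rewrite -mulrBl normrM ler_piMr.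
Qed.

(** The errors |p n - q| meet the hypotheses of [iterated_average_decay], so they decay
    geometrically. The kernel [at_most1] gives convergence to the Dickman function; the Dickman
    kernel with a constant sequence gives uniqueness of [Pi]. *)
Lemma kernel_average_cvg (p : nat -> R -> R) (q k : R -> R) :
  unit_valued k ->
  (forall n x, 0 <= x <= 1 -> p n x = q x) ->
  (forall n v, 0 <= v -> mu.-integrable `[0, v] (EFin \o p n)) ->
  (forall v, 0 <= v -> mu.-integrable `[0, v] (EFin \o q)) ->
  (forall V, exists C, forall x, 0 <= x <= V -> `|p 0%N x - q x| <= C) ->
  (forall n v, 1 < v ->
     v * p n.+1 v = \int[mu]_(t in `[0, v]) (p n t * k (v - t))) ->
  (forall v, 1 < v -> v * q v = \int[mu]_(t in `[0, v]) (q t * k (v - t))) ->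
  forall v, 0 <= v -> p n v @[n --> \oo] --> q v.
Proof.
move=> uk pq ip iq pqC pS qE v v0.
(* The decay estimate requires 1 <= V, also when [v] is small. *)
pose V := Num.max 1 v.
have V1 : 1 <= V by rewrite le_max lexx.
have vV : v <= V by rewrite le_max lexx orbT.
have V0 : 0 < V by exact: lt_le_trans V1.
have [C hC] := pqC V.
have decay n : `|p n v - q v| <= C * ((V - 1) / V) ^+ n.
  apply: (@iterated_average_decay R (fun n x => `|p n x - q x|) V C) => //.
  - by move=> m x x01; rewrite pq// subrr normr0.
  - move=> m x /andP[x0 _]; apply: integrable_norm.
    exact: (integrableB _ (ip m x x0) (iq x x0)).
  - move=> m x /andP[x1 _]; have x0 : 0 < x by exact: lt_trans x1.
    rewrite -[X in X * _]gtr0_norm// -normrM mulrBr pS// qE//.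
    by apply: normr_kernel_average_sub => //; [apply: ip|apply: iq]; exact: ltW.
  - by rewrite v0.
apply/subr_cvg0/norm_cvg0P.
apply: (@squeeze_cvgr _ _ _ _ (cst 0) (geometric C ((V - 1) / V))).
- by near=> n; rewrite /= normr_ge0 decay.
- exact: cvg_cst.
- apply: cvg_geometric.
  rewrite ger0_norm; last by rewrite divr_ge0 ?subr_ge0// ltW.
  by rewrite ltr_pdivrMr// mul1r ltrBlDr ltrDl.
Unshelve. all: by end_near. Qed.

Lemma itv0_integrable_unit (f : R -> R) (v : R) :
  measurable_fun [set x : R | 0 <= x] f ->
  (forall x, 0 <= x -> 0 <= f x <= 1) ->
  mu.-integrable `[0, v] (EFin \o f).
Proof.
move=> mf f01; apply: (@integrable_bounded _ _ _ _ _ _ 1) => //.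
- exact: lebesgue_itv0_lty.
- apply: measurable_funS mf; last by move=> x /=; rewrite in_itv/= => /andP[].
  by rewrite (_ : [set x | 0 <= x] = `[0, +oo[%classic)// set_itvE.
- by move=> x /=; rewrite in_itv/= => /andP[/f01/andP[f0 f1] _]; rewrite ger0_norm.
Qed.

Lemma dickman_approx_cvg (e : R -> R) :
  continuous e -> (forall x, x <= 1 -> e x = 1) ->
  (forall u, 1 < u -> derivable e u 1 /\ u * derive1 e u = - e (u - 1)) ->
  forall v, 0 <= v -> dickman_approx n v @[n --> \oo] --> e v.
Proof.
move=> ce e1 de; apply: (@kernel_average_cvg _ _ at_most1).
- exact: unit_valued_at_most1.
- by move=> n x x01; rewrite dickman_approx_eq1// e1//; case/andP: x01.
- move=> n v _; apply: itv0_integrable_unit => [|x _].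
    exact: measurable_funTS (unit_valued_dickman_approx n).1.
  exact: (unit_valued_dickman_approx n).2.
- move=> v _; apply: continuous_compact_integrable; first exact: segment_compact.
  exact: continuous_subspaceT.
- move=> V; have [V0|V0] := leP 0 V; last first.
    by exists 0 => x /andP[x0 /(le_trans x0)]; rewrite leNgt V0.
  (* The initial error is continuous on a compact interval, so its maximum serves as [C]. *)
  have [|c _ hc] := @EVT_max R (fun x => `|dickman_approx 0 x - e x|) 0 V V0.
    apply: continuous_subspaceT => x; apply: cvg_norm.
    by apply: cvgB; [exact: cvg_cst|exact: ce].
  by eexists => x xV; apply: hc; rewrite in_itv.
- move=> n v v1; apply: Rintegral_stick_conv.
  + exact: unit_valued_at_most1.
  + exact: unit_valued_dickman_approx.
  + exact: lt_trans v1.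
- by move=> v v1; exact: dickman_average.
Qed.

(** The constant sequence [p] converges both to [p v] and to [q v]. *)
Lemma kernel_average_unique (p q k : R -> R) : unit_valued k ->
  measurable_fun [set x : R | 0 <= x] p -> measurable_fun [set x : R | 0 <= x] q ->
  (forall x, 0 <= x -> 0 <= p x <= 1) -> (forall x, 0 <= x -> 0 <= q x <= 1) ->
  (forall x, 0 <= x <= 1 -> p x = q x) ->
  (forall v, 1 < v -> v * p v = \int[mu]_(t in `[0, v]) (p t * k (v - t))) ->
  (forall v, 1 < v -> v * q v = \int[mu]_(t in `[0, v]) (q t * k (v - t))) ->
  forall v, 0 <= v -> p v = q v.
Proof.
move=> uk mp mq p01 q01 pq pE qE v v0.
apply: (@cvg_unique R^o _ (p v @[n --> \oo])) => //; first exact: cvg_cst.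
apply: (@kernel_average_cvg (fun=> p) q k) => //.
- by move=> _ w _; exact: itv0_integrable_unit.
- by move=> w _; exact: itv0_integrable_unit.
- move=> V; exists 1 => x /andP[x0 _].
  have /andP[? ?] := p01 x x0; have /andP[? ?] := q01 x x0.
  by rewrite ler_norml; apply/andP; split; lra.
Qed.

Lemma cvg_unit_valued (f : nat -> R -> R) (l : R) x :
  (forall n, unit_valued (f n)) -> f n x @[n --> \oo] --> l -> 0 <= l <= 1.
Proof.
move=> uf fl; have fx01 n : 0 <= f n x <= 1 by exact: (uf n).2.
apply/andP; split.
  by apply: (cvgr_to_ge fl); near=> n; case/andP: (fx01 n).
by apply: (cvgr_to_le fl); near=> n; case/andP: (fx01 n).
Unshelve. all: by end_near. Qed.

(** Pass to the limit on both sides of the truncated recursion; the integrands are dominated by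
    1. *)
Lemma square_cutting_limitE (e G : R -> R) :
  (forall x, 0 <= x -> dickman_approx n x @[n --> \oo] --> e x) ->
  (forall x, square_cutting_approx n x @[n --> \oo] --> G x) ->
  unit_valued e -> measurable_fun setT G ->
  forall v, 0 < v ->
  (v * G v)%:E = (\int[mu]_(t in `[0%R, v]) (G t * e (v - t))%:E)%E.
Proof.
move=> De DG [me e01] mG v v0.
(* The recursion at rank [n.+1] pairs [square_cutting_approx n] with [dickman_approx n.+1]; the
   shifts of index are undone in the limit. *)
pose f n t := (square_cutting_approx n t * dickman_approx n.+1 (v - t))%:E.
have ua n := unit_valued_square_cutting_approx n.
have ud n := unit_valued_dickman_approx n.
have mvt (h : R -> R) : measurable_fun setT h ->
    measurable_fun setT (fun t : R => h (v - t)).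
  by move=> mh; apply: measurableT_comp => //; exact: measurable_funB.
have [||||||_ _] := @dominated_convergence _ _ R mu `[0, v]%classic _ f
    (fun t => (G t * e (v - t))%:E) (cst 1%E).
- by [].
- move=> n; apply/measurable_EFinP/measurable_funTS/measurable_funM.
    exact: (ua n).1.
  exact: mvt (ud n.+1).1.
- by apply/measurable_EFinP/measurable_funTS/measurable_funM => //; exact: mvt.
- apply: aeW => t /=; rewrite in_itv/= => /andP[t0 tv].
  apply: cvg_EFin; first by near=> n.
  apply: cvgM; first exact: DG.
  by rewrite (cvg_shiftS (fun n => dickman_approx n (v - t))); apply: De; rewrite subr_ge0.
- have -> : cst 1%E = EFin \o cst (1 : R) by [].
  apply: (@integrable_bounded _ _ _ _ _ _ 1) => //; first exact: lebesgue_itv0_lty.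
  by move=> x _; rewrite normr1.
- apply: aeW => t n _; rewrite /f lee_fin.
  have /andP[? ?] := unit_valuedM (ua n) (ud n.+1) t (v - t).
  by rewrite ger0_norm.
have fE : (fun n => (\int[mu]_(t in `[0%R, v]) f n t)%E) =
          (fun n => (v * square_cutting_approx n.+1 v)%:E).
  by apply/funext => n; rewrite -stick_convE.
rewrite fE => lim1.
apply: cvg_unique lim1 => //.
apply: cvg_EFin; first by near=> n.
apply: cvgM; first exact: cvg_cst.
by rewrite (cvg_shiftS (fun n => square_cutting_approx n v)); exact: DG.
Unshelve. all: by end_near. Qed.

End approximants.

(** * The truncated partition as a chain *)

Section cutting_states.
Context (R : realType).
Let Rm := measurableTypeR R.
Let S := (Rm * Rm * Rm)%type.
Let unif : probability Rm R := uniform_prob (@ltr01 R).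

(* A state (z, c, b) records the largest finished part z, the uncut rest c of
   the current row and the total length b of the rows not yet started. *)
Definition cut_step (ij : nat * nat) (s : S) (x : R) : S :=
  let: (z, c, b) := s in
  if ij.2 == 0%N then (z, b * x, b * (1 - x))
  else (Num.max z (c * x), c * (1 - x), b).

Definition row_cells (i j k : nat) : seq (nat * nat) :=
  [seq (i, s) | s <- iota j k].

(** Listed in the order in which the chain consumes them. The row at offset k from [i] has parts
    with index 1 to n - k, whence the condition i + j <= n when the start is row 0. *)
Fixpoint triangle_cells (i n : nat) : seq (nat * nat) :=
  if n is m.+1 then (i, 0%N) :: row_cells i 1 n ++ triangle_cells i.+1 m
  else [::].

Lemma mem_triangle_cells i n ij : ij \in triangle_cells i n -> (i <= ij.1)%N.
Proof.
elim: n i => // n ih i; rewrite in_cons mem_cat => /orP[/eqP -> //|/orP[]].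
  by move=> /mapP[s _ ->].
by move=> /ih /ltnW.
Qed.

Lemma uniq_triangle_cells i n : uniq (triangle_cells i n).
Proof.
elim: n i => // n ih i; rewrite cons_uniq cat_uniq ih andbT mem_cat negb_or.
apply/andP; split.
  apply/andP; split; last by apply/negP => /mem_triangle_cells; rewrite ltnn.
  by apply/negP => /mapP[s]; rewrite mem_iota => /andP[+ _] [s0]; rewrite -s0.
apply/andP; split; first by rewrite map_inj_uniq ?iota_uniq// => x y [].
apply/hasPn => ij /mem_triangle_cells ilt; apply/negP => /mapP[s _ e].
by move: ilt; rewrite e ltnn.
Qed.

Lemma measurable_cut_step ij :
  measurable_fun setT (fun p : S * Rm => cut_step ij p.1 p.2).
Proof.
have mx : measurable_fun setT (fun p : S * Rm => p.2 : R) by exact: measurable_snd.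
have m1 : measurable_fun setT (fun p : S * Rm => p.1) by exact: measurable_fst.
have m11 : measurable_fun setT (fun p : S * Rm => p.1.1).
  exact: measurableT_comp measurable_fst m1.
have mz : measurable_fun setT (fun p : S * Rm => p.1.1.1 : R).
  exact: measurableT_comp measurable_fst m11.
have mc : measurable_fun setT (fun p : S * Rm => p.1.1.2 : R).
  exact: measurableT_comp measurable_snd m11.
have mb : measurable_fun setT (fun p : S * Rm => p.1.2 : R).
  exact: measurableT_comp measurable_snd m1.
have m1x : measurable_fun setT (fun p : S * Rm => 1 - p.2 : R).
  exact: measurable_funB.
have [j0|j0] := eqVneq ij.2 0%N.
  rewrite (_ : (fun p : S * Rm => _) =
      (fun p : S * Rm => (p.1.1.1, p.1.2 * p.2, p.1.2 * (1 - p.2)))); last first.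
    by apply/funext => -[[[z c] b] x] /=; rewrite j0.
  apply: (@measurable_fun_pair _ _ _ _ (Rm * Rm)%type Rm).
    by apply: (@measurable_fun_pair _ _ _ _ Rm Rm) => //; exact: measurable_funM.
  exact: measurable_funM.
rewrite (_ : (fun p : S * Rm => _) =
    (fun p : S * Rm => (Num.max p.1.1.1 (p.1.1.2 * p.2), p.1.1.2 * (1 - p.2), p.1.2)));
    last first.
  by apply/funext => -[[[z c] b] x] /=; rewrite (negbTE j0).
apply: (@measurable_fun_pair _ _ _ _ (Rm * Rm)%type Rm) => //.
apply: (@measurable_fun_pair _ _ _ _ Rm Rm); last exact: measurable_funM.
by apply: measurable_maxr => //; exact: measurable_funM.
Qed.

Definition finished_at_most1 (s : S) : \bar R := (at_most1 s.1.1)%:E.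

(** Makes the part recorded so far a factor that leaves the integral. *)
Lemma at_most1_max (x y : R) : at_most1 (Num.max x y) = at_most1 x * at_most1 y.
Proof.
rewrite /at_most1 !indicE -natrM mulnb; congr (nat_of_bool _)%:R.
by apply/idP/andP; rewrite !inE/= !in_itv/= ge_max => /andP.
Qed.

(** Inside a row each cut records c x and leaves c (1 - x), which is the recursion of
    [dickman_approx]. Positivity of [j] keeps [cut_step] in its second branch. *)
Lemma backward_row i j k l (G : R -> R) : (0 < j)%N -> (forall x, 0 <= G x) ->
  (forall z c b, backward cut_step finished_at_most1 l (z, c, b) =
                 (at_most1 z * G b)%:E) ->
  forall z c b, backward cut_step finished_at_most1 (row_cells i j k ++ l) (z, c, b) =
                (at_most1 z * dickman_approx k c * G b)%:E.
Proof.
move=> + G0 hl; elim: k j => [|k ih] j j0 z c b.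
  by rewrite hl mulr1.
rewrite /=.
under eq_integral => x _ do rewrite gtn_eqF// ih// at_most1_max.
have ud := unit_valued_dickman_approx R k.
have u1 := unit_valued_at_most1 R.
transitivity (\int[unif]_x ((at_most1 z * G b)%:E *
    (at_most1 (c * x) * dickman_approx k (c * (1 - x)))%:E))%E.
  by apply: eq_integral => x _; rewrite -EFinM; congr EFin; ring.
rewrite ge0_integralZl//; last first.
- by rewrite lee_fin mulr_ge0//; case/andP: (u1.2 z).
- by move=> x _; rewrite lee_fin; case/andP: (unit_valuedM u1 ud (c * x) (c * (1 - x))).
- by apply/measurable_EFinP; exact: measurable_stick_integrand.
rewrite -EFin_stick_conv// -EFinM; congr EFin.
rewrite -[stick_conv _ _ c]/(dickman_approx k.+1 c); ring.
Qed.

(** The row cut overwrites [c] by b x, from which the row yields [dickman_approx n.+1], and hands b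
    (1 - x) to the rows below. *)
Lemma backward_triangle i n z c b :
  backward cut_step finished_at_most1 (triangle_cells i n) (z, c, b) =
  (at_most1 z * square_cutting_approx n b)%:E.
Proof.
elim: n i z c b => [|n ih] i z c b; first by rewrite mulr1.
have us := unit_valued_square_cutting_approx R n.
have ud := unit_valued_dickman_approx R n.+1.
have u1 := unit_valued_at_most1 R.
transitivity (\int[unif]_x backward cut_step finished_at_most1
    (row_cells i 1 n.+1 ++ triangle_cells i.+1 n) (z, (b * x)%R, (b * (1 - x))%R))%E.
  by [].
have us0 (y : R) : 0 <= square_cutting_approx n y by case/andP: (us.2 y).
under eq_integral => x _ do rewrite (@backward_row i 1 n.+1 _ _ isT us0 (ih _)).
transitivity (\int[unif]_x ((at_most1 z)%:E *
    (dickman_approx n.+1 (b * x) * square_cutting_approx n (b * (1 - x)))%:E))%E.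
  by apply: eq_integral => x _; rewrite -EFinM mulrA.
rewrite ge0_integralZl//; last first.
- by rewrite lee_fin; case/andP: (u1.2 z).
- by move=> x _; rewrite lee_fin; case/andP: (unit_valuedM ud us (b * x) (b * (1 - x))).
- by apply/measurable_EFinP; exact: measurable_stick_integrand.
by rewrite -EFin_stick_conv.
Qed.

Section deterministic_run.
Variable u : nat -> nat -> R.

Let run (s : S) (ij : nat * nat) : S := cut_step ij s (u ij.1 ij.2).

(** The piece with index [j] is recorded first; all later ones share the factor 1 - u i j, absorbed
    into the new [c]. *)
Lemma run_row i j k z c b : (0 < j)%N -> exists z' c',
  foldl run (z, c, b) (row_cells i j k) = (z', c', b) /\
  (z' <= 1 <-> z <= 1 /\ forall s, (j <= s < j + k)%N ->
     c * (\prod_(j <= r < s) (1 - u i r)) * u i s <= 1).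
Proof.
elim: k j z c => [|k ih] j z c j0.
  by exists z, c; split => //; split => [z1|[]//]; split => // s; lia.
have -> : foldl run (z, c, b) (row_cells i j k.+1) =
    foldl run (Num.max z (c * u i j), c * (1 - u i j), b) (row_cells i j.+1 k).
  have -> : (Num.max z (c * u i j), c * (1 - u i j), b) = run (z, c, b) (i, j).
    by rewrite /run /cut_step /= gtn_eqF.
  by [].
have [//|z' [c' [-> zP]]] := ih j.+1 (Num.max z (c * u i j)) (c * (1 - u i j)).
exists z', c'; split => //; rewrite zP ge_max; split.
  move=> [/andP[z1 c1] h]; split => // s sj.
  have [->|js] := eqVneq s j; first by rewrite big_geq// mulr1.
  rewrite big_ltn; last lia.
  by rewrite mulrA; apply: h; lia.
move=> [z1 h]; split.
  rewrite z1/=; have := h j; rewrite big_geq// mulr1; apply; lia.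
move=> s sj; have := h s; rewrite big_ltn; last lia.
rewrite mulrA; apply; lia.
Qed.

(** A part of the partition started at row [i0]. Letting [i0] vary makes the removal of a row an
    induction step; [i0 = 0] gives [sc_part]. *)
Definition part_from (i0 i j : nat) : R :=
  \prod_(i0 <= r < i) (1 - u r 0%N) * u i 0%N *
  \prod_(1 <= s < j) (1 - u i s) * u i j.

Lemma part_fromS i0 i j : (i0 < i)%N ->
  part_from i0 i j = (1 - u i0 0%N) * part_from i0.+1 i j.
Proof. by move=> i0i; rewrite /part_from big_ltn// !mulrA. Qed.

(** Parts with i' = i are recorded by the first row; all others share the factor 1 - u i 0, absorbed
    into the new [b]. *)
Lemma run_triangle i n z c b :
  (foldl run (z, c, b) (triangle_cells i n)).1.1 <= 1 <->
  z <= 1 /\ forall i' j, (i <= i')%N -> (0 < j)%N -> (i' - i + j <= n)%N ->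
     b * part_from i i' j <= 1.
Proof.
elim: n i z c b => [|n ih] i z c b.
  by split => [z1|[]//]; split => // i' j; lia.
have -> : foldl run (z, c, b) (triangle_cells i n.+1) =
    foldl run (foldl run (z, b * u i 0%N, b * (1 - u i 0%N)) (row_cells i 1 n.+1))
      (triangle_cells i.+1 n).
  by rewrite -foldl_cat.
have [//|z' [c' [-> zP]]] := @run_row i 1 n.+1 z (b * u i 0%N) (b * (1 - u i 0%N)).
rewrite ih zP; split.
  move=> [[z1 hi] hS]; split => // i' j ii' j0 ijn.
  have [e|ne] := eqVneq i' i.
    rewrite e /part_from big_geq// mul1r !mulrA; apply: hi; lia.
  rewrite part_fromS; last lia.
  rewrite mulrA; apply: hS; lia.
move=> [z1 h]; split.
  split => // s sn; have := h i s; rewrite /part_from big_geq// mul1r !mulrA.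
  by apply; lia.
move=> i' j ii' j0 ijn; have := h i' j; rewrite part_fromS; last lia.
rewrite mulrA;
apply; lia.
Qed.

End deterministic_run.
End cutting_states.

(** * The law of the largest part *)

Section square_cutting.
Context d (T : measurableType d) (R : realType) (P : probability T R).
Variable U : nat -> nat -> {RV P >-> R}.
Hypothesis iidU : iid_uniform01 U.
Let Rm := measurableTypeR R.

(** Written with a product and without [sup], so that it makes sense at v = 0 and is a countable
    intersection of measurable events. *)
Definition parts_le (v : R) : set T :=
  [set w | forall i j, (0 < j)%N -> v * sc_part U i j w <= 1].

Definition triangle_parts_le (n : nat) (v : R) : set T :=
  [set w | forall i j, (0 < j)%N -> (i + j <= n)%N -> v * sc_part U i j w <= 1].

Lemma measurable_sc_part i j : measurable_fun setT (sc_part U i j).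
Proof.
have m1 k l : measurable_fun setT (fun w => 1 - U k l w).
  by apply: measurable_funB => //; exact: measurable_funP.
apply: measurable_funM; last exact: measurable_funP.
apply: measurable_funM; last by apply: measurable_prod => k _; exact: m1.
apply: measurable_funM; last exact: measurable_funP.
by apply: measurable_prod => k _; exact: m1.
Qed.

Lemma measurable_sc_part_le v i j : measurable [set w | v * sc_part U i j w <= 1].
Proof.
rewrite -[X in measurable X]setTI.
have m : measurable_fun setT (fun w => v * sc_part U i j w).
  by apply: measurable_funM => //; exact: measurable_sc_part.
rewrite (_ : [set w | _] = (fun w => v * sc_part U i j w) @^-1` `]-oo, 1]).
  exact: m.
by apply/seteqP; split => w /=; rewrite in_itv.
Qed.

Lemma measurable_parts_le v : measurable (parts_le v).
Proof.
rewrite (_ : parts_le v = \bigcap_i \bigcap_(j in [set j | (0 < j)%N])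
    [set w | v * sc_part U i j w <= 1]).
  apply: bigcapT_measurable => i; apply: bigcap_measurable => [|j _].
    by exists 1%N.
  exact: measurable_sc_part_le.
apply/seteqP; split => [w h i _ j /= j0|w h i j j0]; first exact: h.
exact: (h i Logic.I j j0).
Qed.

Lemma measurable_triangle_parts_le n v : measurable (triangle_parts_le n v).
Proof.
rewrite (_ : triangle_parts_le n v = \bigcap_i \bigcap_j
  (if (0 < j)%N && (i + j <= n)%N then [set w | v * sc_part U i j w <= 1] else setT)).
  apply: bigcapT_measurable => i; apply: bigcapT_measurable => j.
  by case: ifP => // _; exact: measurable_sc_part_le.
apply/seteqP; split => [w h i _ j _|w h i j j0 ijn].
  by case: ifP => // /andP[j0 ijn]; exact: h.
by have := h i Logic.I j Logic.I; rewrite j0 ijn.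
Qed.

Lemma sc_partE i j w : sc_part U i j w = part_from (fun k l => U k l w) 0 i j.
Proof. by rewrite /sc_part /part_from big_mkord. Qed.

(** The indicator of the event is the payoff of a run along the triangle. The start is
    deterministic, so the expectation is the value function there. *)
Lemma probability_triangle_parts_le n v :
  P (triangle_parts_le n v) = (square_cutting_approx n v)%:E.
Proof.
(* The recorded part 0 respects the bound 1, the row rest 0 is overwritten by the first cell, and
   the scale [v] enters as the initial length. *)
pose s0 : Rm * Rm * Rm := (0, 0, v).
have ms0 : measurable_fun setT (fun _ : T => s0) by exact: measurable_cst.
pose Y : {RV P >-> (Rm * Rm * Rm)%type} := mfun_Sub (mem_set ms0).
pose X (ij : nat * nat) : {RV P >-> R} := U ij.1 ij.2.
have lawX ij (A : set R) : measurable A ->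
    distribution P (X ij) A = uniform_prob (@ltr01 R) A.
  by move=> mA; exact: iidU.1.
have indY : independent_of_rest X Y (triangle_cells 0 n).
  move=> B C mB mC.
  rewrite -(iidU.2 (triangle_cells 0 n) C (uniq_triangle_cells 0 n))//.
  (* A constant state makes the event about [Y] either sure or empty. *)
  have [Bs|Bs] := pselect (B s0).
    rewrite (_ : Y @^-1` B = setT); last by apply/seteqP; split.
    by rewrite setTI probability_setT mul1e.
  rewrite (_ : Y @^-1` B = set0); last by apply/seteqP; split.
  by rewrite set0I measure0 mul0e.
have mphi : measurable_fun setT (@finished_at_most1 R).
  apply/measurable_EFinP; apply: measurableT_comp.
    exact: (unit_valued_at_most1 R).1.
  exact: (measurableT_comp measurable_fst measurable_fst).
have phi0 s : (0 <= @finished_at_most1 R s)%E.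
  by rewrite lee_fin; case/andP: ((unit_valued_at_most1 R).2 s.1.1).
have := integral_chain lawX (@measurable_cut_step R) (uniq_triangle_cells 0 n) indY mphi phi0.
rewrite (eq_integral (fun w => (\1_(triangle_parts_le n v) w)%:E)); last first.
  move=> w _; rewrite /finished_at_most1 /at_most1 !indicE.
  congr ((nat_of_bool _)%:R)%:E.
  have := run_triangle (fun k l => U k l w) 0 n 0 0 v.
  set z := (X in X <= 1); move=> zP.
  apply/idP/idP; rewrite !inE/= in_itv/= -/z.
    move=> /zP[_ h] i j j0 ijn; rewrite sc_partE; apply: h => //.
    by rewrite subn0.
  move=> h; apply/zP; split; first exact: ler01.
  by move=> i j _ j0 ijn; rewrite -sc_partE; apply: h => //; rewrite -[i]subn0.
rewrite integral_indic//; last exact: measurable_triangle_parts_le.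
rewrite setIT => ->.
rewrite (eq_integral (fun w => (square_cutting_approx n v)%:E)); last first.
  move=> w _; rewrite backward_triangle at_most1_eq1 ?mul1r// lexx ler01//.
rewrite integral_cst// [X in (_ * X)%E](_ : _ = 1%E) ?mule1//.
exact: probability_setT.
Qed.

Definition largest_part_cdf_inv (v : R) : R := fine (P (parts_le v)).

Lemma EFin_largest_part_cdf_inv v :
  (largest_part_cdf_inv v)%:E = P (parts_le v).
Proof. by rewrite fineK// fin_num_measure//; exact: measurable_parts_le. Qed.

(** The triangles exhaust all cells, so this is continuity from above of [P]. *)
Lemma largest_part_cdf_inv_cvg v :
  square_cutting_approx n v @[n --> \oo] --> largest_part_cdf_inv v.
Proof.
have eq_cap : parts_le v = \bigcap_n triangle_parts_le n v.
  apply/seteqP; split => [w h n _ i j j0 _|w h i j j0]; first exact: h.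
  exact: (h (i + j)%N Logic.I i j j0 (leqnn _)).
have : (P \o (fun n => triangle_parts_le n v)) @ \oo --> P (\bigcap_n triangle_parts_le n v).
  apply: nonincreasing_cvg_mu.
  - by rewrite -ge0_fin_numE// fin_num_measure//; exact: measurable_triangle_parts_le.
  - by move=> n; exact: measurable_triangle_parts_le.
  - by rewrite -eq_cap; exact: measurable_parts_le.
  - move=> m n mn; apply/subsetPset => w h i j j0 ijm.
    by apply: h => //; exact: leq_trans mn.
rewrite -eq_cap -EFin_largest_part_cdf_inv.
rewrite (_ : _ \o _ = EFin \o (fun n => square_cutting_approx n v)).
  by move=> /fine_cvg.
by apply/funext => n; rewrite /= probability_triangle_parts_le.
Qed.

Lemma largest_part_cdf_inv01 v : 0 <= largest_part_cdf_inv v <= 1.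
Proof.
apply: (cvg_unit_valued _ (@largest_part_cdf_inv_cvg v)) => n.
exact: unit_valued_square_cutting_approx.
Qed.

(** Read off the approximants rather than from a pointwise bound on the parts, because the variables
    lie in [0, 1] only almost surely. *)
Lemma largest_part_cdf_inv_eq1 v : 0 <= v <= 1 -> largest_part_cdf_inv v = 1.
Proof.
move=> v01; have := @largest_part_cdf_inv_cvg v.
under eq_fun do rewrite square_cutting_approx_eq1//.
by move=> h; apply: cvg_unique h _ => //; exact: cvg_cst.
Qed.

Lemma measurable_largest_part_cdf_inv : measurable_fun setT largest_part_cdf_inv.
Proof.
apply: (measurable_fun_cvg _ (fun v _ => @largest_part_cdf_inv_cvg v)) => n.
exact: (unit_valued_square_cutting_approx R n).1.
Qed.

(* Where the parts are unbounded (a null event) sup takes the junk value 0. *)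
Lemma probability_sc_largest_le (u : R) : 0 < u ->
  P [set w | sc_largest U w <= u] = (largest_part_cdf_inv u^-1)%:E.
Proof.
move=> u0; rewrite EFin_largest_part_cdf_inv.
(* The event that the parts have no upper bound; it is null because [parts_le 1] has probability
   1. *)
pose N := ~` (\bigcup_n parts_le n.+1%:R^-1).
have mN : measurable N.
  by apply/measurableC/bigcupT_measurable => n; exact: measurable_parts_le.
have N0 : P N = 0%E.
  have P1 : P (parts_le 1) = 1%E.
    by rewrite -EFin_largest_part_cdf_inv largest_part_cdf_inv_eq1// lexx ler01.
  apply: (@subset_measure0 _ _ _ _ _ (~` parts_le 1)) => //.
  - by apply: measurableC; exact: measurable_parts_le.
  - by apply: subsetC => w h; exists 0%N => //; rewrite invr1.
  - transitivity (1 - P (parts_le 1))%E; last by rewrite P1 subee.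
    exact: (probability_setC P (measurable_parts_le 1)).
have scaleE (v x : R) : 0 < v -> (v^-1 * x <= 1) = (x <= v).
  by move=> v0; rewrite mulrC ler_pdivrMr// mul1r.
have E0 w : [set x | exists i j : nat, (0 < j)%N /\ x = sc_part U i j w] !=set0.
  by exists (sc_part U 0 1 w), 0%N, 1%N.
rewrite (_ : [set w | sc_largest U w <= u] = parts_le u^-1 `|` N).
  by rewrite measureU0//; exact: measurable_parts_le.
apply/seteqP; split => w /=.
  move=> wu; have [[n _ hn]|hN] := pselect ((\bigcup_n parts_le n.+1%:R^-1) w); last by right.
  left => i j j0; rewrite scaleE//; apply: le_trans wu.
  apply: ub_le_sup; last by exists i, j.
  exists n.+1%:R => _ [k [l [l0 ->]]].
  by have := hn k l l0; rewrite scaleE.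
case=> [h|hN].
  apply: ge_sup; first exact: E0.
  by move=> _ [k [l [l0 ->]]]; have := h k l l0; rewrite scaleE.
rewrite /sc_largest sup_out ?ltW// => -[_ [M hM]]; apply: hN.
have [n Mn] : exists n, M <= n.+1%:R :> R.
  by exists (Num.truncn M); apply: ltW; exact: truncnS_gt.
exists n => // i j j0; rewrite scaleE//.
by apply: le_trans Mn; apply: hM; exists i, j.
Qed.

End square_cutting.

(** * Existence and uniqueness of [Pi] *)

Lemma dickman_approx_cvg_extend1 (R : realType) (rho : R -> R) :
  is_dickman rho ->
  forall v, 0 <= v -> dickman_approx n v @[n --> \oo] --> extend1 rho v.
Proof.
move=> rhoD; apply: dickman_approx_cvg.
- exact: continuous_extend1.
- exact: extend1_eq1.
- exact: derive_extend1.
Qed.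

(** [is_dickman] states no bounds; they pass to the limit from [dickman_approx]. *)
Lemma unit_valued_extend1 (R : realType) (rho : R -> R) :
  is_dickman rho -> unit_valued (extend1 rho).
Proof.
move=> rhoD; split.
  by apply: continuous_measurable_fun; exact: continuous_extend1.
move=> x; have [x0|x0] := leP 0 x; last first.
  by rewrite extend1_eq1 ?lexx ?ler01// (le_trans (ltW x0)).
apply: (cvg_unit_valued _ (@dickman_approx_cvg_extend1 R rho rhoD x x0)) => n.
exact: unit_valued_dickman_approx.
Qed.

Lemma integral_extend1 (R : realType) (rho p : R -> R) (v : R) :
  (\int[lebesgue_measure]_(t in `[0%R, v]) (p t * extend1 rho (v - t))%:E =
   \int[lebesgue_measure]_(t in `[0%R, v]) (p t * rho (v - t))%:E)%E.
Proof.
apply: eq_integral => t; rewrite inE/= in_itv/= => /andP[_ tv].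
by rewrite extend1E// subr_ge0.
Qed.

Lemma largest_part_cdf_invE d (T : measurableType d) (R : realType)
    (P : probability T R) (U : nat -> nat -> {RV P >-> R}) (rho : R -> R) (v : R) :
  iid_uniform01 U -> is_dickman rho -> 0 < v ->
  (v * largest_part_cdf_inv U v)%:E =
  (\int[lebesgue_measure]_(t in `[0%R, v])
     (largest_part_cdf_inv U t * extend1 rho (v - t))%:E)%E.
Proof.
move=> iidU rhoD v0; apply: square_cutting_limitE => //.
- exact: dickman_approx_cvg_extend1.
- exact: largest_part_cdf_inv_cvg.
- exact: unit_valued_extend1.
- exact: measurable_largest_part_cdf_inv.
Qed.

Lemma is_Pi_largest_part_cdf_inv d (T : measurableType d) (R : realType)
    (P : probability T R) (U : nat -> nat -> {RV P >-> R}) (rho : R -> R) :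
  iid_uniform01 U -> is_dickman rho -> is_Pi rho (largest_part_cdf_inv U).
Proof.
move=> iidU rhoD; split.
  by apply: measurable_funTS; exact: measurable_largest_part_cdf_inv.
split; first by apply: largest_part_cdf_inv_eq1; rewrite // lexx ler01.
split; first by move=> u _; exact: largest_part_cdf_inv01.
split=> [u /andP[u0 u1]|u u1].
  by apply: largest_part_cdf_inv_eq1; rewrite // ltW.
have u0 : 0 < u by exact: lt_trans u1.
by rewrite -integral_extend1 -largest_part_cdf_invE// -EFinM mulKf// lt0r_neq0.
Qed.

Lemma is_Pi_average (R : realType) (rho p : R -> R) (v : R) :
  is_Pi rho p -> 1 < v ->
  v * p v = \int[lebesgue_measure]_(t in `[0, v]) (p t * extend1 rho (v - t)).
Proof.
move=> [_ [_ [_ [_ pE]]]] v1; rewrite /Rintegral integral_extend1.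
have v0 : v != 0 by rewrite gt_eqF// (lt_trans ltr01).
(* Writing 1 as v / v produces the factor v^-1 with which [pE] can be read backwards. *)
rewrite -[X in fine X]mul1e -[1%E]/(1%:E) -(divff v0) EFinM -muleA -pE//.
Qed.

(** Contraction with kernel [extend1 rho]; the bounds in [is_Pi] give integrability and the initial
    estimate. *)
Lemma is_Pi_unique (R : realType) (rho p q : R -> R) : is_dickman rho ->
  is_Pi rho p -> is_Pi rho q -> forall v, 0 <= v -> p v = q v.
Proof.
move=> rhoD pP qP.
have ge0_01 r : is_Pi rho r -> forall x, 0 <= x -> 0 <= r x <= 1.
  move=> [_ [r0 [r01 _]]] x; rewrite le_eqVlt => /predU1P[<-|/r01//].
  by rewrite r0 lexx ler01.
have eq1 r : is_Pi rho r -> forall x, 0 <= x <= 1 -> r x = 1.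
  move=> [_ [r0 [_ [r1 _]]]] x /andP[+ x1].
  by rewrite le_eqVlt => /predU1P[<-//|x0]; apply: r1; rewrite x0.
apply: (kernel_average_unique (unit_valued_extend1 rhoD)).
- exact: pP.1.
- exact: qP.1.
- exact: ge0_01.
- exact: ge0_01.
- by move=> x x01; rewrite (eq1 p)// (eq1 q).
- by move=> v; exact: is_Pi_average.
- by move=> v; exact: is_Pi_average.
Qed.

Theorem mainTheorem3 (R : realType) (d : measure_display) (T : measurableType d)
  (P : probability T R) (U : nat -> nat -> {RV P >-> R}) (rho : R -> R) :
  iid_uniform01 U -> is_dickman rho ->
  (exists Pi : R -> R, is_Pi rho Pi) /\
  (forall Pi : R -> R, is_Pi rho Pi ->
     forall u : R, 0 < u ->
       P [set w | sc_largest U w <= u] = (Pi u^-1)%:E).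
Proof.
move=> iidU rhoD; have GP := is_Pi_largest_part_cdf_inv iidU rhoD; split.
  by exists (largest_part_cdf_inv U).
move=> Pi PiP u u0; rewrite probability_sc_largest_le//; congr EFin.
by apply: (is_Pi_unique rhoD GP PiP); rewrite invr_ge0 ltW.
Qed.
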